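(* Let $s$ be a positive integer not divisible by $4$, let $m\ge 3$ be an odd integer, let $n=sm$, and let $\Gamma=C_n[mK_1]$. Then $\Gamma$ is the skeleton of (1) a chiral polytopal map of type $\{mn,2m\}$ on an orientable surface of genus $1+m\left(n\frac{m-1}{2}-1\right)$; (2) an orientable reflexible polytopal map of type $\{n,2m\}$ on an orientable surface of genus $1+m\left(n\frac{m-1}{2}-m\right)$; (3) a non-orientable reflexible polytopal map of type $\{2n,2m\}$ on a non-orientable surface of (non-orientable) genus $2+m\left(n(m-1)-m\right)$.
   Context: A map is a finite connected graph (its skeleton), viewed as a 1-dimensional CW complex, embedded in a closed surface so that every connected component of the complement (a face) is homeomorphic to an open disk. The map is polytopal if the boundary of each face is a cycle of the skeleton and every edge lies on the boundary of exactly two distinct faces. An automorphism of a map is an automorphism of the skeleton that extends to a homeomorphism of the surface; these form the group $\mathrm{Aut}(\mathcal M)$. A map is rotary if the stabiliser of each vertex contains a cyclic group acting transitively on the edges incident to it, and the stabiliser of each face contains a cyclic group acting transitively on the vertices (and edges) of the face. A rotary map has type $\{p,q\}$ if each face has $p$ edges on its boundary and the skeleton is $q$-valent. A rotary map is reflexible if the stabiliser of a face also contains an automorphism acting as a reflection of that face; a reflexible map is orientable or non-orientable according to its surface; a rotary map on an orientable surface that is not reflexible is called chiral. Genus: an orientable surface of Euler characteristic $\chi$ has genus $(2-\chi)/2$; a non-orientable surface of Euler characteristic $\chi$ has (non-orientable) genus $2-\chi$. The graph $C_n[mK_1]$ (lexicographic product of the $n$-cycle with the edgeless graph on $m$ vertices)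 has vertex set $\{1,\dots,n\}\times\{1,\dots,m\}$, with $(i_1,j_1)$ adjacent to $(i_2,j_2)$ if and only if $i_1\equiv i_2\pm1 \pmod n$. *)

(* Defs.v *)
(* Maps are encoded combinatorially by flag systems
   (Jones--Singerman / Wilson): a finite set F of flags with three
   fixed-point-free involutions r0 r1 r2 such that r0 r2 = r2 r0 is also a
   fixed-point-free involution and <r0,r1,r2> is transitive.
   Vertices / edges / faces are the orbits of <r1,r2> / <r0,r2> / <r0,r1>. *)
From mathcomp Require Import all_boot all_order all_fingroup all_algebra.
Set Implicit Arguments. Unset Strict Implicit. Unset Printing Implicit Defensive.
Import GRing.Theory Num.Theory.

Section Maps.
Variable F : finType.
Variables r0 r1 r2 : {perm F}.

Definition gen2 (a b : {perm F}) : rel F := fun x y => (y == a x) || (y == b x).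
Definition same_vertex : rel F := connect (gen2 r1 r2).
Definition same_edge   : rel F := connect (gen2 r0 r2).
Definition same_face   : rel F := connect (gen2 r0 r1).
Definition connected_flags : Prop :=
  forall x y : F, connect (fun u v => [|| v == r0 u, v == r1 u | v == r2 u]) x y.

Definition is_map : Prop :=
  [/\ forall x, r0 (r0 x) = x /\ r0 x != x,
      forall x, r1 (r1 x) = x /\ r1 x != x,
      forall x, r2 (r2 x) = x /\ r2 x != x,
      forall x, r0 (r2 x) = r2 (r0 x) /\ r0 (r2 x) != x
    & connected_flags].

Definition num_vertices : nat := #|[set [set y | same_vertex x y] | x : F]|.
Definition num_edges    : nat := #|[set [set y | same_edge x y] | x : F]|.
Definition num_faces    : nat := #|[set [set y | same_face x y] | x : F]|.
Definition euler_char : int :=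
  (Posz num_vertices - Posz num_edges + Posz num_faces)%R.

Definition orientable : Prop :=
  exists c : F -> bool, forall x,
    [/\ c (r0 x) = ~~ c x, c (r1 x) = ~~ c x & c (r2 x) = ~~ c x].

(* The skeleton is isomorphic to the (simple) graph adj on V:
   vt sends each flag to its vertex; it induces a bijection between vertices
   of the map and V, and a bijection between edges of the map (with their
   endpoints) and edges of adj. *)
Definition skeleton_is (V : finType) (adj : rel V) : Prop :=
  exists vt : F -> V,
    [/\ forall x y, (vt x == vt y) = same_vertex x y,
        forall v, exists x, vt x = v,
        forall x, adj (vt x) (vt (r0 x)),
        forall x y, vt x = vt y -> vt (r0 x) = vt (r0 y) -> same_edge x y
      & forall u v, adj u v -> exists x, vt x = u /\ vt (r0 x) = v].

(* polytopal: the boundary walk of each face is a cycle (passes through each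
   vertex at most once, i.e. meets each vertex in at most one corner
   {x, r1 x}), and the two sides of every edge lie on distinct faces *)
Definition polytopal : Prop :=
  (forall x y, same_face x y -> same_vertex x y -> y = x \/ y = r1 x) /\
  (forall x, ~~ same_face x (r2 x)).

Definition map_aut : {set {perm F}} :=
  [set g : {perm F} | [forall x, [&& g (r0 x) == r0 (g x),
                                      g (r1 x) == r1 (g x) &
                                      g (r2 x) == r2 (g x)]]].

Definition rotary : Prop :=
  (forall f, exists g, [/\ g \in map_aut,
      forall h, h \in <[g]>%g -> same_vertex f (h f)
    & forall x, same_vertex f x -> exists2 h, h \in <[g]>%g & same_edge x (h f)])
  /\
  (forall f, exists g, [/\ g \in map_aut,
      forall h, h \in <[g]>%g -> same_face f (h f)
    & forall x, same_face f x -> exists2 h, h \in <[g]>%g & same_vertex x (h f)]).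

(* reflexible: rotary, and each face stabiliser contains a reflection of the
   face, i.e. an automorphism acting on the flags of the face as an odd
   element (r0 r1)^k r1 of the dihedral group <r0, r1> *)
Definition reflexible : Prop :=
  rotary /\
  (forall f, exists2 g, g \in map_aut &
      exists k, g f = iter k (fun x => r0 (r1 x)) (r1 f)).

Definition chiral : Prop := [/\ rotary, orientable & ~ reflexible].

Definition has_type (p q : nat) : Prop :=
  forall f, #|[set y | same_face f y]| = (2 * p)%N /\
            #|[set y | same_vertex f y]| = (2 * q)%N.

End Maps.

Definition cyc_adj (n : nat) (i1 i2 : 'I_n) : bool :=
  (i1 == (i2 + 1) %% n :> nat) || (i2 == (i1 + 1) %% n :> nat).
Definition lex_cycle_adj (n m : nat) : rel ('I_n * 'I_m) :=
  fun u v => cyc_adj u.1 v.1.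
Arguments lex_cycle_adj : clear implicits.
Arguments cyc_adj : clear implicits.

(* Main.v *)
From HB Require Import structures.
Require Import Defs.
From mathcomp Require Import all_boot all_order all_fingroup all_algebra.
From mathcomp Require Import ring zify.
Set Implicit Arguments. Unset Strict Implicit. Unset Printing Implicit Defensive.
Import GRing.Theory.

(* The vertices of (1) and (2) form an abelian group V, the quotient of
   Z x Z/m by the subgroup generated by (n, -c), with c = 1 for (1) and c = 0
   for (2); e is the image of (1, 0) and z embeds Z/m, so that v is adjacent to
   the v + e + z d and the v - e + z d. The rotation at v sends the arc to
   v + e + z d to the arc to v - e + z (1 - d), and the one to v - e + z d to
   the arc to v + e + z (- 1 - d). Along a face the coordinate in Z/m has
   constant second difference 1 or -1, hence, m being odd and dividing n, after
   n steps a face comes back to its first vertex shifted by the multiple n e of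
   e. This is 0 for c = 0 and a generator of z (Z/m) for c = 1, whence the face
   lengths n and m n.
   The translations of V, the shears and v |-> - v are automorphisms and make
   the map rotary. The reflection (i, j) |-> (i, - j) survives in V only for
   c = 0; for c = 1 the sign of the shift of a face after n steps, compared with
   that of the rotation at a vertex, tells the two orientations apart.
   For n odd, (3) is the Petrie dual of (2). For n = 2 mod 4 it is another map,
   in which the rotation at (i, j) sends (i + 1, k) to (i - 1, k + 1) and
   (i - 1, k) to (i + 1, k + 1), and the edges between the classes i and i + 1
   reverse the local orientation exactly for i even. *)

(** * Flag systems and their automorphisms *)

Lemma connect_preserves (T : finType) (e : rel T) (P : T -> Prop) :
  (forall y z, P y -> e y z -> P z) ->
  forall x y, connect e x y -> P x -> P y.
Proof.
move=> Pe x y /connectP[p xp ->]; elim: p x xp => //= z p IH x /andP[xz zp] Px.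
exact: IH zp (Pe _ _ Px xz).
Qed.

Section TwoInvolutions.
Variables (F : finType) (a b : {perm F}).
Hypotheses (aK : involutive a) (bK : involutive b).
Let f x := a (b x).

Lemma gen2_sym : connect_sym (gen2 a b).
Proof.
apply: sym_connect_sym => x y; rewrite /gen2.
by congr orb; apply/eqP/eqP => ->; rewrite ?aK ?bK.
Qed.

Lemma dihedral_inj : injective f.
Proof. by move=> x y /perm_inj /perm_inj. Qed.

Lemma gen2_iter t x : connect (gen2 a b) x (iter t f x).
Proof.
elim: t => //= t IH; apply: connect_trans IH _.
apply: (@connect_trans _ _ (b (iter t f x))); apply: connect1.
  by rewrite /gen2 eqxx orbT.
by rewrite /gen2 eqxx.
Qed.

Lemma gen2_connectP x y :
  reflect (exists t, y = iter t f x \/ y = b (iter t f x))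
          (connect (gen2 a b) x y).
Proof.
apply: (iffP idP) => [|[t [->|->]]].
- move/(@connect_preserves _ _
    (fun y => exists t, y = iter t f x \/ y = b (iter t f x))).
  apply; last by exists 0; left.
  move=> {}y w [t yE] /orP[/eqP->|/eqP->]; last first.
    by exists t; case: yE => ->; [right | left; rewrite bK].
  case: yE => ->; last by exists t.+1; left.
  case: t => [|t]; last by exists t; right; rewrite /= aK.
  (* At [t = 0], going round the whole cycle of [f] writes [a x] as [b (iter k f x)], where [k + 1]
     is the length of the cycle. *)
  have /= := fingraph.iter_order dihedral_inj x.
  case: (fingraph.order f x) (fingraph.order_gt0 f x) => // k _ /= fk.
  by exists k; right; rewrite -[in LHS]fk aK.
- exact: gen2_iter.
- apply: connect_trans (gen2_iter t x) (connect1 _).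
  by rewrite /gen2 eqxx orbT.
Qed.

(** The colouring [c] is constant on the [p] iterates of [f] and takes the other value on their
    images under [b], so the orbit is the disjoint union of two sets of size [p]. *)
Lemma card_dihedral_orbit (c : F -> bool) p x :
  (forall y, c (a y) = ~~ c y) -> (forall y, c (b y) = ~~ c y) -> 0 < p ->
  iter p f x = x -> (forall t, iter t f x = x -> p %| t) ->
  #|[set y | connect (gen2 a b) x y]| = 2 * p.
Proof.
move=> ca cb p0 fp fmin.
have c_iter t : c (iter t f x) = c x.
  by elim: t => //= t <-; rewrite ca cb negbK.
have inj_iter : injective (fun t : 'I_p => iter t f x).
  have key (t u : 'I_p) : t <= u -> iter t f x = iter u f x -> t = u.
    move=> tu /esym; rewrite -(subnKC tu) iterD => E.
    have inj_t : injective (iter t f).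
      by elim: (nat_of_ord t) => //= k IH; apply: inj_comp => //; apply: dihedral_inj.
    move: (fmin _ (inj_t _ _ E)); have := ltn_ord u => up pd.
    apply/val_inj/eqP; rewrite eqn_leq tu -subn_eq0 /=.
    by apply: contraLR pd; rewrite -lt0n => ?; rewrite gtnNdvd //; lia.
  by move=> t u /= E; case/orP: (leq_total t u) => le; [|apply/esym]; apply: key.
pose A := [set iter t f x | t : 'I_p].
have iterA t : iter t f x \in A.
  apply/imsetP; exists (Ordinal (ltn_pmod t p0)) => //=.
  rewrite {1}(divn_eq t p) addnC iterD; congr (iter _ _ _).
  by elim: (t %/ p) => //= k IH; rewrite mulSn iterD IH.
have -> : [set y | connect (gen2 a b) x y] = A :|: [set b y | y in A].
  apply/setP=> y; rewrite !inE; apply/gen2_connectP/orP.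
    case=> t [->|->]; [by left; apply: iterA|right].
    by apply: imset_f.
  case=> [/imsetP[t _ ->]|/imsetP[_ /imsetP[t _ ->] ->]].
    by exists t; left.
  by exists t; right.
have cA : #|A| = p by rewrite card_imset // card_ord.
rewrite cardsU (card_imset _ perm_inj) cA.
have -> : A :&: [set b y | y in A] = set0.
  apply/setP=> y; rewrite !inE; apply/negP=> /andP[/imsetP[t _ ->]].
  case/imsetP=> _ /imsetP[u _ ->] /(congr1 c); rewrite cb !c_iter.
  by case: (c x).
by rewrite cards0 subn0 mul2n addnn.
Qed.

Lemma card_gen2_classes k :
  (forall x, #|[set y | connect (gen2 a b) x y]| = k) ->
  #|[set [set y | connect (gen2 a b) x y] | x : F]| * k = #|F|.
Proof.
move=> ck; set P := [set _ | x : F].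
have eqR : {in [set: F] & &, equivalence_rel (connect (gen2 a b))}.
  move=> x y w _ _ _; split; first exact: connect0.
  by move=> xy; apply/idP/idP; apply: connect_trans; rewrite // gen2_sym.
have PE : P = equivalence_partition (connect (gen2 a b)) [set: F].
  apply/setP=> B; apply/imsetP/imsetP=> -[x _ ->]; exists x; rewrite ?inE //;
    by apply/setP=> y; rewrite !inE.
rewrite -cardsT (@card_uniform_partition _ k P setT) //.
  by move=> _ /imsetP[x _ ->].
by rewrite PE; apply: equivalence_partitionP.
Qed.

End TwoInvolutions.

Section FlagSystem.
Variables (F : finType) (r0 r1 r2 : {perm F}).
Hypotheses (r0K : involutive r0) (r1K : involutive r1) (r2K : involutive r2).

Lemma map_aut1 : 1%g \in map_aut r0 r1 r2.
Proof. by rewrite inE; apply/forallP=> x; rewrite !perm1 !eqxx. Qed.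

Lemma map_autP (g : {perm F}) :
  reflect (forall x, [/\ g (r0 x) = r0 (g x), g (r1 x) = r1 (g x)
                       & g (r2 x) = r2 (g x)]) (g \in map_aut r0 r1 r2).
Proof.
rewrite inE; apply: (iffP forallP) => H x; have := H x.
  by case/and3P=> /eqP ? /eqP ? /eqP.
by case=> -> -> ->; rewrite !eqxx.
Qed.

Lemma map_autM g h :
  g \in map_aut r0 r1 r2 -> h \in map_aut r0 r1 r2 -> (g * h)%g \in map_aut r0 r1 r2.
Proof.
move=> /map_autP G /map_autP H; apply/map_autP=> x; rewrite !permM.
by have [-> -> ->] := G x; have [-> -> ->] := H (g x).
Qed.

Lemma map_autV g : g \in map_aut r0 r1 r2 -> (g^-1)%g \in map_aut r0 r1 r2.
Proof.
move=> /map_autP G; apply/map_autP=> x; have := G ((g^-1)%g x); rewrite permKV.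
by case=> G0 G1 G2; split; apply: (@perm_inj _ g); rewrite permKV.
Qed.

Definition aut_eq x y := exists2 g : {perm F}, g \in map_aut r0 r1 r2 & g x = y.

Lemma aut_eq_refl x : aut_eq x x.
Proof. by exists 1%g; [apply: map_aut1 | rewrite perm1]. Qed.

Lemma aut_eq_sym x y : aut_eq x y -> aut_eq y x.
Proof. by case=> g gA <-; exists (g^-1)%g; [apply: map_autV | rewrite permK]. Qed.

Lemma aut_eq_trans y x w : aut_eq x y -> aut_eq y w -> aut_eq x w.
Proof.
case=> g gA <- [h hA <-]; exists (g * h)%g; first exact: map_autM.
by rewrite permM.
Qed.

(* By connectedness a map commuting with the three involutions is onto. *)
Lemma aut_eq_fun (h : F -> F) x :
  connected_flags r0 r1 r2 ->
  (forall y, [/\ h (r0 y) = r0 (h y), h (r1 y) = r1 (h y) & h (r2 y) = r2 (h y)]) ->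
  aut_eq x (h x).
Proof.
move=> conn hC.
have h_surj y : y \in codom h.
  apply: (@connect_preserves _ _ (fun y => y \in codom h) _ _ _ (conn (h x) y)).
    move=> {}y w /codomP[u ->] /or3P[] /eqP->; apply/codomP.
    - by exists (r0 u); case: (hC u).
    - by exists (r1 u); case: (hC u).
    - by exists (r2 u); case: (hC u).
  exact: codom_f.
have h_inj : injective h.
  apply/injectiveP; rewrite /dinjectiveb; apply/card_uniqP.
  rewrite size_map -cardE; apply: eq_card => y; exact: h_surj.
exists (perm h_inj); last by rewrite permE.
by apply/map_autP=> y; rewrite !permE.
Qed.

(** An automorphism commutes with the rotation, so if it acts on [x] as one rotation, its powers act
    on [x] as the iterates do. The remaining flags of the vertex are images of these under [r2],
    hence on the same edges; those of the face are images under [r1], hence at the same vertices. *)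
Lemma rotary_of_aut_eq :
  (forall x, aut_eq x (r1 (r2 x))) -> (forall x, aut_eq x (r0 (r1 x))) ->
  rotary r0 r1 r2.
Proof.
have cyc (g a b : {perm F}) x t : (forall y, g (a y) = a (g y)) ->
    (forall y, g (b y) = b (g y)) -> g x = a (b x) ->
    (g ^+ t)%g x = iter t (fun y => a (b y)) x.
  move=> ga gb gx; rewrite permX; elim: t => //= t ->.
  by elim: t => //= t IH; rewrite ga gb IH.
move=> vrot frot; split=> x.
  have [g gA gx] := vrot x; have /map_autP gC := gA; exists g; split=> //.
    move=> h /cycleP[t ->].
    rewrite (cyc _ r1 r2) => [|y|y|//]; try by case: (gC y).
    exact: gen2_iter.
  move=> y /(gen2_connectP r1K r2K)[t yE].
  exists (g ^+ t)%g; first exact: mem_cycle.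
  rewrite (cyc _ r1 r2) => [|w|w|//]; try by case: (gC w).
  case: yE => ->; first exact: connect0.
  by apply: connect1; rewrite /gen2 r2K eqxx orbT.
have [g gA gx] := frot x; have /map_autP gC := gA; exists g; split=> //.
  move=> h /cycleP[t ->].
  rewrite (cyc _ r0 r1) => [|y|y|//]; try by case: (gC y).
  exact: gen2_iter.
move=> y /(gen2_connectP r0K r1K)[t yE].
exists (g ^+ t)%g; first exact: mem_cycle.
rewrite (cyc _ r0 r1) => [|w|w|//]; try by case: (gC w).
case: yE => ->; first exact: connect0.
by apply: connect1; rewrite /gen2 r1K eqxx.
Qed.

Lemma reflexible_of_aut_eq : (forall x y, aut_eq x y) -> reflexible r0 r1 r2.
Proof.
move=> H; split; first exact: rotary_of_aut_eq.
by move=> x; have [g gA gx] := H x (r1 x); exists g => //; exists 0.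
Qed.

End FlagSystem.

(** * Maps with skeleton C_n[mK_1] *)

Definition signed (U : zmodType) (b : bool) (u : U) : U := (if b then - u else u)%R.

Lemma cyc_adjE n (i j : 'I_n.+2) :
  cyc_adj n.+2 i j = (i == j + 1)%R || (j == i + 1)%R.
Proof.
rewrite /cyc_adj -!val_eqE /=.
by rewrite (modn_small (isT : 1 < n.+2)).
Qed.

Lemma natr_ordE n (i : 'I_n.+2) : ((nat_of_ord i)%:R = i)%R.
Proof. by apply: val_inj; rewrite /= Zp_nat /= modn_small. Qed.

Lemma natr_ord0 n k : (k%:R == 0 :> 'I_n.+2)%R = (n.+2 %| k).
Proof. by rewrite Zp_nat -val_eqE. Qed.

Lemma cyc1_neqN1 n : (1 != - 1 :> 'I_n.+3)%R.
Proof. by rewrite -subr_eq0 opprK -(natrD _ 1 1) natr_ord0 gtnNdvd. Qed.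

Lemma odd_multiple_of_2 n (d : 'I_n.+2) : odd n.+2 -> exists t, (d = 2%:R *+ t)%R.
Proof.
(* Half of the modulus plus one is the inverse of 2. *)
move=> nodd; exists (d * (n.+3)./2).
rewrite -mulrnA mulnC -mulnA muln2 (halfK n.+3).
have -> : odd n.+3 = false by rewrite -[RHS]/(~~ true) -nodd.
by rewrite subn0 natrM mulrSr natr_ordE (eqP (_ : n.+2%:R == 0)%R) ?natr_ord0 // add0r mulr1.
Qed.

Section FlagCoordinates.
Variables (n m : nat) (W : finType) (idx : W -> 'I_n * 'I_m).
Local Notation flag := (W * bool * 'I_m * bool)%type.
Definition flag_vertex (x : flag) := idx x.1.1.1.
Definition flag_dir (x : flag) : bool := x.1.1.2.
End FlagCoordinates.

(* A flag [(w, dl, d, s)] lies at the vertex [w]; its edge leads to the next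
   ([dl = false]) or to the previous ([dl = true]) class of the cycle and is
   singled out there by [d]; [s] is the side of the edge. *)
Record lex_flags (n' m' : nat) (W : finType) (idx : W -> 'I_n'.+3 * 'I_m'.+3)
    (r0 r1 r2 : {perm W * bool * 'I_m'.+3 * bool}) (h : bool -> bool -> bool) : Prop :=
  LexFlags {
    lf_r0K : involutive r0;
    lf_r1K : involutive r1;
    lf_r2E : forall w dl d s, r2 (w, dl, d, s) = (w, dl, d, ~~ s);
    lf_r0_dir : forall x, flag_dir (r0 x) = ~~ flag_dir x;
    lf_r1_dir : forall x, flag_dir (r1 x) = ~~ flag_dir x;
    lf_r02 : forall x, r0 (r2 x) = r2 (r0 x);
    lf_r1_vt : forall x, flag_vertex idx (r1 x) = flag_vertex idx x;
    lf_rot2 : forall w dl d s, r1 (r2 (r1 (r2 (w, dl, d, s)))) =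
      (w, dl, d + signed (h dl s) 2%:R, s)%R;
    lf_r0_block : forall x, ((flag_vertex idx (r0 x)).1 =
      (flag_vertex idx x).1 + signed (flag_dir x) 1)%R;
    lf_r0_inj : forall w dl d d' s s',
      flag_vertex idx (r0 (w, dl, d, s)) = flag_vertex idx (r0 (w, dl, d', s')) ->
      d = d' }.

Section LexCycleMaps.
Variables (n' m' : nat).
Local Notation n := n'.+3.
Local Notation m := m'.+3.
Hypothesis m_odd : odd m.
Variables (W : finType) (idx : W -> 'I_n * 'I_m).
Hypothesis idx_bij : bijective idx.
Local Notation flag := (W * bool * 'I_m * bool)%type.
Local Notation vt := (flag_vertex idx).
Local Notation dir := (@flag_dir _ W).
Variables (r0 r1 r2 : {perm flag}) (h : bool -> bool -> bool).
Hypothesis LF : lex_flags idx r0 r1 r2 h.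
Let r0K := lf_r0K LF.
Let r1K := lf_r1K LF.
Let r2E := lf_r2E LF.
Let r0_dir := lf_r0_dir LF.
Let r1_dir := lf_r1_dir LF.
Let r02 := lf_r02 LF.
Let r1_vt := lf_r1_vt LF.
Let rot2 := lf_rot2 LF.
Let r0_block := lf_r0_block LF.
Let r0_inj := lf_r0_inj LF.

Lemma lex_r2K : involutive r2.
Proof. by move=> [[[w dl] d] s]; rewrite !r2E negbK. Qed.

Lemma lex_r2_dir x : dir (r2 x) = dir x.
Proof. by case: x => [[[w dl] d] s]; rewrite r2E. Qed.

Lemma lex_r2_vt x : vt (r2 x) = vt x.
Proof. by case: x => [[[w dl] d] s]; rewrite r2E. Qed.

Lemma lex_rot_iter t w dl d s :
  iter (2 * t) (fun y => r1 (r2 y)) (w, dl, d, s) =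
  (w, dl, d + signed (h dl s) 2%:R *+ t, s)%R.
Proof.
elim: t => [|t IH]; first by rewrite addr0.
by rewrite mulnS iterD IH /= rot2 -addrA -mulrSr.
Qed.

(** Any flag can be turned about its vertex to a canonical one: [r1] corrects the direction, [r2]
    the side, and the double rotation changes [d] by 2 or -2, which generates Z/m as [m] is odd. *)
Lemma lex_same_vertex x y : (vt x == vt y) = same_vertex r1 r2 x y.
Proof.
apply/eqP/idP; last first.
  move=> xy; apply/esym.
  move: xy (erefl (vt x)); apply: (@connect_preserves _ _ (fun y => vt y = vt x)).
  by move=> u v <- /orP[/eqP->|/eqP->]; rewrite ?r1_vt ?lex_r2_vt.
have sym := gen2_sym r1K lex_r2K.
have canon z : same_vertex r1 r2 z (z.1.1.1, false, 0%R, false).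
  have s2 u v : r2 u = v -> same_vertex r1 r2 u v.
    by move<-; apply: connect1; rewrite /gen2 eqxx orbT.
  have s1 u v : r1 u = v -> same_vertex r1 r2 u v.
    by move<-; apply: connect1; rewrite /gen2 eqxx.
  have dir_false u : dir u = false ->
      same_vertex r1 r2 u (u.1.1.1, false, 0%R, false).
    case: u => [[[w dl] d] s]; rewrite /dir /= => ->.
    apply: (@connect_trans _ _ (w, false, d, false)).
      by case: s; [apply: s2; rewrite r2E | apply: connect0].
    (* The sign is chosen so that [t] double rotations cancel [d]. *)
    have [t dE] := odd_multiple_of_2 (signed (~~ h false false) d) m_odd.
    have := gen2_iter r1 r2 (2 * t) (w, false, d, false).
    rewrite lex_rot_iter; congr (connect _ _ (_, _, _, _)).
    move: dE; rewrite /signed; case: (h false false) => /= E.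
      by rewrite mulNrn -E subrr.
    by rewrite -E addrN.
  case E: (dir z); last exact: dir_false.
  apply: (@connect_trans _ _ (r1 z)); first exact: s1.
  have := dir_false (r1 z); rewrite r1_dir E => /(_ erefl).
  by have /(bij_inj idx_bij) -> := r1_vt z.
move/(bij_inj idx_bij) => E.
by apply: connect_trans (canon x) _; rewrite E sym; apply: canon.
Qed.

(** The classes of the two ends determine the direction, since 1 and -1 differ in Z/n; then [r0_inj]
    determines [d]. Only the side is left free, and [r2] exchanges the sides. *)
Lemma lex_same_edge x y :
  vt x = vt y -> vt (r0 x) = vt (r0 y) -> same_edge r0 r2 x y.
Proof.
move=> xy xy0.
have dxy : dir x = dir y.
  have := congr1 fst xy0; rewrite /= !r0_block xy => /addrI.
  rewrite /signed; case: (dir x); case: (dir y) => //= E.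
    by case/eqP: (cyc1_neqN1 n').
  by case/eqP: (cyc1_neqN1 n').
move: x y dxy xy xy0 => [[[w dl] d] s] [[[w' dl'] d'] s'].
rewrite /dir /= => <- /(bij_inj idx_bij) /= <- /r0_inj <-.
have [->|] := eqVneq s s'; first exact: connect0.
move=> ss; apply: connect1; rewrite /gen2 r2E.
have -> : s' = ~~ s by case: s s' ss => -[].
by rewrite eqxx orbT.
Qed.

(** The map from [d] to the fibre coordinate of the far end is an injection of Z/m into itself,
    hence onto. *)
Lemma lex_arc u v : (v.1 = u.1 + 1)%R ->
  exists x, [/\ vt x = u, dir x = false & vt (r0 x) = v].
Proof.
case: idx_bij => g gK Kg vE.
pose T d := (vt (r0 (g u, false, d, false))).2.
have T1 d : (vt (r0 (g u, false, d, false))).1 = v.1.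
  by rewrite r0_block /vt /= Kg vE.
have Tinj : injective T.
  move=> d d' E; apply: (r0_inj (w := g u) (dl := false) (s := false) (s' := false)).
  by apply/eqP; rewrite -pair_eqE /pair_eq !T1 eqxx; apply/eqP.
have [T' _ KT'] := injF_bij Tinj.
exists (g u, false, T' v.2, false); split; rewrite /vt /= ?Kg //.
apply/eqP; rewrite -pair_eqE /pair_eq; have /= := T1 (T' v.2).
by rewrite /vt /= => ->; rewrite eqxx; apply/eqP; apply: KT'.
Qed.

Lemma lex_skeleton : skeleton_is r0 r1 r2 (lex_cycle_adj n m).
Proof.
exists vt; split.
- exact: lex_same_vertex.
- by move=> v; case: idx_bij => g gK Kg; exists (g v, false, 0%R, false); rewrite /vt /= Kg.
- move=> x; rewrite /lex_cycle_adj cyc_adjE r0_block /signed.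
  by case: (dir x); rewrite ?subrK eqxx ?orbT.
- exact: lex_same_edge.
- move=> u v; rewrite /lex_cycle_adj cyc_adjE => /orP[/eqP uE|/eqP vE].
    by have [x [xv _ xu]] := lex_arc uE; exists (r0 x); rewrite r0K.
  by have [x [xv _ xu]] := lex_arc vE; exists x.
Qed.

Lemma lex_connected : connected_flags r0 r1 r2.
Proof.
move=> x y; set e := (fun _ _ => _).
have sub_e u v : same_vertex r1 r2 u v -> connect e u v.
  apply: connect_sub => {}u {}v /orP[]/eqP->; apply: connect1; rewrite /e eqxx ?orbT //.
have step u i : ((vt u).1 + 1 = i)%R -> forall k, exists2 v, connect e u v & vt v = (i, k).
  move=> <- k; have [w [wu _ wi]] := @lex_arc (vt u) ((vt u).1 + 1, k)%R erefl.
  exists (r0 w) => //; apply: (@connect_trans _ _ w).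
    by apply: sub_e; rewrite -lex_same_vertex wu.
  by apply: connect1; rewrite /e eqxx.
have walk t k : exists2 v, connect e x v & vt v = ((vt x).1 + t.+1%:R, k)%R.
  elim: t k => [|t IH] k; first exact: step.
  have [v xv vE] := IH 0%R; have [|w vw wE] := @step v ((vt x).1 + t.+2%:R)%R _ k.
    by rewrite vE /= -addrA -mulrSr.
  by exists w => //; apply: connect_trans xv vw.
pose d := ((vt y).1 - (vt x).1)%R.
(* A walk has at least one step; [d + n] steps lead to the class of [y] even when [d] is 0. *)
have [v xv vE] := walk (d + n.-1) (vt y).2.
apply: connect_trans xv (sub_e _ _ _); rewrite -lex_same_vertex vE.
have -> : ((d + n.-1).+1%:R = d)%R.
  rewrite -addnS natrD natr_ordE (_ : n.-1.+1%:R = 0)%R ?addr0 //.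
  by apply/eqP; rewrite natr_ord0.
by rewrite /d addrC subrK; case: (vt y).
Qed.

Lemma lex_is_map : is_map r0 r1 r2.
Proof.
have neq (x y : flag) : dir x = ~~ dir y -> x != y.
  by move=> E; apply/eqP=> xy; move: E; rewrite xy; case: (dir y).
split; last exact: lex_connected.
- by move=> x; rewrite r0K neq.
- by move=> x; rewrite r1K neq.
- move=> x; rewrite lex_r2K; split=> //; case: x => [[[w dl] d] s].
  by rewrite r2E; apply/eqP=> -[]; case: s.
- by move=> x; rewrite r02 neq // lex_r2_dir r0_dir.
Qed.

Variable p : nat.
Hypothesis p_gt0 : 0 < p.
Hypothesis face_period : forall x, iter p (fun y => r0 (r1 y)) x = x.
Hypothesis face_simple : forall t x,
  vt (iter t (fun y => r0 (r1 y)) x) = vt x -> p %| t.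

(** A face meets the vertex of [x] again only after a multiple of [p] steps, and is then back at
    [x]. Since [r2 x] is at the vertex of [x], on the same face it would be [x] or [r1 x]; the side
    excludes the first, the direction the second. *)
Lemma lex_polytopal : polytopal r0 r1 r2.
Proof.
have face_corner x y : same_face r0 r1 x y -> same_vertex r1 r2 x y -> y = x \/ y = r1 x.
  have corner t : vt (iter t (fun y => r0 (r1 y)) x) = vt x ->
      iter t (fun y => r0 (r1 y)) x = x.
    move=> /face_simple /dvdnP[k ->].
    by elim: k => //= k IH; rewrite mulSn iterD IH face_period.
  move=> /(gen2_connectP r0K r1K)[t yE]; rewrite -lex_same_vertex => /eqP vxy.
  case: yE vxy => ->; first by move=> /esym /corner ->; left.
  by rewrite r1_vt => /esym /corner ->; right.
split=> // x; apply/negP=> xf; have [] := face_corner _ _ xf.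
- by apply: connect1; rewrite /gen2 eqxx orbT.
- case: x {xf} => [[[w dl] d] s].
  by rewrite r2E; case; case: s.
- move/(congr1 dir); rewrite lex_r2_dir r1_dir.
  by case: (dir x).
Qed.

Lemma lex_has_type : has_type r0 r1 r2 p (2 * m).
Proof.
move=> x; split.
  apply: (@card_dihedral_orbit _ _ _ r0K r1K dir) => // t E.
  by apply: (@face_simple _ x); rewrite E.
have -> : [set y | same_vertex r1 r2 x y] =
    [set ((x.1.1.1, c.1.1, c.1.2, c.2) : flag) | c : bool * 'I_m * bool].
  apply/setP=> y; rewrite !inE -lex_same_vertex; apply/eqP/imsetP.
    case: y => [[[w dl] d] s] /(bij_inj idx_bij) /= <-.
    by exists (dl, d, s).
  by case=> c _ ->.
rewrite card_imset; last by move=> [[a b] c] [[a' b'] c'] [-> -> ->].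
by rewrite !card_prod card_bool card_ord; lia.
Qed.

(** The [4nm^2] flags are counted by vertices ([4m] each), edges (4 each) and faces ([2p] each); [k]
    is the number of faces. *)
Lemma lex_euler k : k * p = 2 * n * m * m ->
  euler_char r0 r1 r2 = (Posz (n * m) - Posz (n * m * m) + Posz k)%R.
Proof.
move=> kp.
have cF : #|{: flag}| = 4 * n * m * m.
  rewrite !card_prod card_bool card_ord.
  by rewrite (bij_eq_card idx_bij) card_prod !card_ord; lia.
have nv : num_vertices r1 r2 * (2 * (2 * m)) = #|{: flag}|.
  by apply: (card_gen2_classes r1K lex_r2K) => x; case: (lex_has_type x).
have nf : num_faces r0 r1 * (2 * p) = #|{: flag}|.
  by apply: (card_gen2_classes r0K r1K) => x; case: (lex_has_type x).
have ne : num_edges r0 r2 * 4 = #|{: flag}|.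
  apply: (card_gen2_classes r0K lex_r2K) => x.
  have -> : [set y | connect (gen2 r0 r2) x y] = [set x; r0 x; r2 x; r0 (r2 x)].
    apply/setP=> y; rewrite !inE -!orbA; apply/(gen2_connectP r0K lex_r2K)/or4P.
      case=> t; have -> : iter t (fun y => r0 (r2 y)) x = if odd t then r0 (r2 x) else x.
        elim: t => //= t ->; case: (odd t) => //=.
        by rewrite r02 r0K lex_r2K.
      case: (odd t) => -[] ->; rewrite ?r02 ?lex_r2K ?eqxx; by [apply: Or41 | apply: Or42 | apply: Or43|apply: Or44].
    case=> /eqP ->.
    - by exists 0; left.
    - by exists 1; right; rewrite /= -r02 lex_r2K.
    - by exists 0; right.
    - by exists 1; left.
  have [H0 _ H2 H02 _] := lex_is_map.
  have [_ h0] := H0 x; have [_ h2] := H2 x; have [_ h02] := H02 x.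
  have h3 : r2 x != r0 x by apply/eqP=> /(congr1 dir); rewrite lex_r2_dir r0_dir; case: (dir x).
  have h4 : r0 (r2 x) != r0 x by rewrite (inj_eq perm_inj).
  have h5 : r0 (r2 x) != r2 x by case: (H0 (r2 x)).
  rewrite setUC cardsU1 !inE !negb_or h02 h4 h5 /=.
  by rewrite setUC cardsU1 !inE negb_or h2 h3 cards2 eq_sym h0.
rewrite /euler_char; move: nv nf ne; rewrite cF.
set a := num_vertices _ _; set b := num_edges _ _; set c := num_faces _ _.
move=> av cv bv.
have -> : a = n * m by apply/eqP; rewrite -(eqn_pmul2r (isT : 0 < 4 * m)) //; apply/eqP; lia.
have -> : b = n * m * m by lia.
have -> : c = k; last by [].
apply/eqP; rewrite -(eqn_pmul2r p_gt0); apply/eqP; lia.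
Qed.

Lemma lex_map k : k * p = 2 * n * m * m ->
  [/\ is_map r0 r1 r2 /\ polytopal r0 r1 r2,
      skeleton_is r0 r1 r2 (lex_cycle_adj n m), has_type r0 r1 r2 p (2 * m)
    & euler_char r0 r1 r2 = (Posz (n * m) - Posz (n * m * m) + Posz k)%R].
Proof.
move=> kp; split; last exact: lex_euler.
- split; [exact: lex_is_map | exact: lex_polytopal].
- exact: lex_skeleton.
- exact: lex_has_type.
Qed.

End LexCycleMaps.

(** * Maps on the vertex group V *)

Section Signed.
Local Open Scope ring_scope.

Lemma signedN (U : zmodType) b (u : U) : signed (~~ b) u = - signed b u.
Proof. by case: b; rewrite /signed ?opprK. Qed.

Lemma signed_add (U U' : zmodType) (f : {additive U -> U'}) b u :
  f (signed b u) = signed b (f u).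
Proof. by case: b; rewrite /signed ?raddfN. Qed.

Lemma signedMn (U : zmodType) b (u : U) k : signed b u *+ k = signed b (u *+ k).
Proof. by case: b; rewrite /signed ?mulNrn. Qed.

Lemma signed_eq0 (U : zmodType) b (u : U) : (signed b u == 0) = (u == 0).
Proof. by case: b; rewrite /signed ?oppr_eq0. Qed.

End Signed.

Section TranslationMaps.
Local Open Scope ring_scope.
Variables (n' m' : nat).
Local Notation n := n'.+3.
Local Notation m := m'.+3.
Hypotheses (m_odd : odd m) (m_dvd_n : (m %| n)%N).
Variables (V : finZmodType) (e : V).
Variables (z : {additive 'I_m -> V}) (blk : {additive V -> 'I_n}).
Hypotheses (blk_e : blk e = 1) (blk_z : forall d, blk (z d) = 0).
Hypotheses (z_inj : injective z) (blk_ker : forall v, blk v = 0 -> exists d, v = z d).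

(** The classes are the cosets of the image of [z], represented by [e *+ i] for [i < n]. By
    [blk_ker] the default 0 is never taken. *)
Definition coset_coord (v : V) : 'I_n * 'I_m :=
  (blk v, odflt 0 [pick d | v == e *+ blk v + z d]).

Lemma blk_eMn k : blk (e *+ k) = k%:R.
Proof. by rewrite raddfMn blk_e. Qed.

Lemma coset_coord_bij : bijective coset_coord.
Proof.
exists (fun c => e *+ (c.1 : 'I_n) + z c.2) => [v | [i j]] /=; rewrite /coset_coord /=.
  case: pickP => [d /eqP //|none].
  have [|d dE] := @blk_ker (v - e *+ blk v).
    by rewrite raddfB /= blk_eMn natr_ordE subrr.
  by have := none d; rewrite -dE addrC subrK eqxx.
have -> : blk (e *+ (i : 'I_n) + z j) = i.
  by rewrite raddfD /= blk_eMn natr_ordE blk_z addr0.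
case: pickP => /= [d /eqP/addrI/z_inj -> //|/(_ j)].
by rewrite eqxx.
Qed.

(** As [m] divides [n], this is a morphism from [V] to Z/m; the shears are built from it. *)
Definition vertex_res (v : V) : 'I_m := (nat_of_ord (blk v))%:R.

Lemma natr_blk k : ((k %% n)%N%:R = k%:R :> 'I_m).
Proof.
rewrite [in RHS](divn_eq k n) natrD natrM.
have -> : n%:R = 0 :> 'I_m by apply/eqP; rewrite natr_ord0.
by rewrite mulr0 add0r.
Qed.

Lemma vertex_resD v w : vertex_res (v + w) = vertex_res v + vertex_res w.
Proof. by rewrite /vertex_res raddfD -natrD /= natr_blk. Qed.

Lemma vertex_res_z d : vertex_res (z d) = 0.
Proof. by rewrite /vertex_res blk_z. Qed.

Lemma vertex_res0 : vertex_res 0 = 0.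
Proof. by rewrite -(raddf0 z) vertex_res_z. Qed.

Lemma vertex_resN v : vertex_res (- v) = - vertex_res v.
Proof. by apply/eqP; rewrite -addr_eq0 -vertex_resD addNr vertex_res0. Qed.

Lemma vertex_res_e : vertex_res e = 1.
Proof. by rewrite /vertex_res blk_e. Qed.

Local Notation flag := (V * bool * 'I_m * bool)%type.

(* The flag [(v, dl, d, s)] lies at the vertex [v], on the edge joining it to
   [v + e + z d] or to [v - e + z d] according to [dl]; [s] selects the side.
   For [eps = false] one gets the Petrie dual of the map for [eps = true]. *)
Variable eps : bool.
Definition tr0_fun (x : flag) : flag :=
  let: (v, dl, d, s) := x in (v + signed dl e + z d, ~~ dl, - d, s (+) eps).
Definition tr1_fun (x : flag) : flag :=
  let: (v, dl, d, s) := x in (v, ~~ dl, - d + signed (dl (+) s) 1, ~~ s).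
Definition tr2_fun (x : flag) : flag :=
  let: (v, dl, d, s) := x in (v, dl, d, ~~ s).

Lemma tr0_funK : involutive tr0_fun.
Proof.
move=> [[[v dl] d] s] /=; rewrite negbK opprK addbK signedN raddfN.
by congr (_, _, _, _); rewrite addrAC !addrK.
Qed.
Lemma tr1_funK : involutive tr1_fun.
Proof.
move=> [[[v dl] d] s] /=; rewrite !negbK opprD opprK addbN addNb negbK.
by rewrite subrK.
Qed.
Lemma tr2_funK : involutive tr2_fun.
Proof. by move=> [[[v dl] d] s] /=; rewrite negbK. Qed.

Definition tr0 : {perm flag} := perm (inv_inj tr0_funK).
Definition tr1 : {perm flag} := perm (inv_inj tr1_funK).
Definition tr2 : {perm flag} := perm (inv_inj tr2_funK).

Lemma tr0E v dl d s :
  tr0 (v, dl, d, s) = (v + signed dl e + z d, ~~ dl, - d, s (+) eps).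
Proof. by rewrite permE. Qed.
Lemma tr1E v dl d s :
  tr1 (v, dl, d, s) = (v, ~~ dl, - d + signed (dl (+) s) 1, ~~ s).
Proof. by rewrite permE. Qed.
Lemma tr2E v dl d s : tr2 (v, dl, d, s) = (v, dl, d, ~~ s).
Proof. by rewrite permE. Qed.

Lemma tr0K : involutive tr0.
Proof. by move=> x; rewrite !permE tr0_funK. Qed.
Lemma tr1K : involutive tr1.
Proof. by move=> x; rewrite !permE tr1_funK. Qed.

Local Notation vt := (flag_vertex coset_coord).

Lemma tr0_dir (x : flag) : flag_dir (tr0 x) = ~~ flag_dir x.
Proof. by case: x => [[[v dl] d] s]; rewrite tr0E. Qed.
Lemma tr1_dir (x : flag) : flag_dir (tr1 x) = ~~ flag_dir x.
Proof. by case: x => [[[v dl] d] s]; rewrite tr1E. Qed.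
Lemma tr1_vt (x : flag) : vt (tr1 x) = vt x.
Proof. by case: x => [[[v dl] d] s]; rewrite tr1E. Qed.
Lemma tr02 (x : flag) : tr0 (tr2 x) = tr2 (tr0 x).
Proof. by case: x => [[[v dl] d] s]; rewrite !(tr0E, tr2E) addNb. Qed.

Lemma tr_rot2 v dl d s : tr1 (tr2 (tr1 (tr2 (v, dl, d, s)))) =
  (v, dl, d + signed (dl (+) s) 2%:R, s).
Proof.
rewrite !(tr1E, tr2E) !negbK addbN addNb addbN negbK signedN.
congr (_, _, _, _); case: (dl (+) s); rewrite /signed; ring.
Qed.

Lemma tr0_block (x : flag) : (vt (tr0 x)).1 = (vt x).1 + signed (flag_dir x) 1.
Proof.
case: x => [[[v dl] d] s]; rewrite tr0E /flag_vertex /coset_coord /flag_dir /=.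
by rewrite !raddfD /= signed_add blk_e blk_z addr0.
Qed.

Lemma tr0_inj v dl d d' s s' :
  vt (tr0 (v, dl, d, s)) = vt (tr0 (v, dl, d', s')) -> d = d'.
Proof.
rewrite !tr0E /flag_vertex /=.
by move/(bij_inj coset_coord_bij)/addrI/z_inj.
Qed.

Lemma tr_face_step v dl d s : tr0 (tr1 (v, dl, d, s)) =
  (v - signed dl e - z (d - signed (dl (+) s) 1), dl,
   d - signed (dl (+) s) 1, s (+) ~~ eps).
Proof.
rewrite tr1E tr0E negbK signedN.
have -> : - d + signed (dl (+) s) 1 = - (d - signed (dl (+) s) 1).
  by rewrite opprB addrC.
by rewrite opprK raddfN addNb addbN.
Qed.

(** As [m] is prime to 2, it is enough that it divides [(k + 1) k]. *)
Lemma bin2_dvd k : (m %| k)%N -> (m %| 'C(k.+1, 2))%N.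
Proof.
move=> mk; rewrite -(@Gauss_dvdr m 2) ?coprimen2 //.
have -> : (2 * 'C(k.+1, 2) = k.+1 * k)%N.
  by rewrite mul2n bin2 -[in RHS](odd_double_half (k.+1 * k)) oddM /= andNb.
exact: dvdn_mull.
Qed.

Local Notation face := (fun y : flag => tr0 (tr1 y)).

Lemma face_walkD v w a b A B :
  v - w *+ a - z A - w *+ b - z B = v - w *+ (a + b) - z (A + B).
Proof. by rewrite raddfD mulrnDr !opprD !addrA [_ - z A - _]addrAC. Qed.

(** Each step changes [d] by the same sign, and the values of [d] add up in the fibre to a quadratic
    function of [t]. *)
Lemma tr_face_iter t v dl d s : eps -> iter t face (v, dl, d, s) =
  (v - signed dl e *+ t - z (d *+ t - signed (dl (+) s) 1 *+ 'C(t.+1, 2)),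
   dl, d - signed (dl (+) s) 1 *+ t, s).
Proof.
move=> eps1; elim: t => [|t IH].
  by rewrite bin_small // !mulr0n !subr0 raddf0 subr0.
rewrite iterS IH tr_face_step eps1 addbF (binS t.+1 1) bin1.
rewrite -{2}(mulr1n (signed dl e)) face_walkD addn1.
set u := signed _ 1.
congr (_ - z _, _, _, _); ring.
Qed.

(** The side now alternates, so the second step undoes the change of [d] made by the first and the
    fibre coordinate moves linearly. *)
Lemma tr_face_iter2 t v dl d s : ~~ eps -> iter (2 * t) face (v, dl, d, s) =
  (v - signed dl e *+ (2 * t) - z ((d *+ 2 - signed (dl (+) s) 1) *+ t),
   dl, d, s).
Proof.
move=> /negbTE eps0; elim: t => [|t IH].
  by rewrite muln0 !mulr0n (raddf0 z) !subr0.
rewrite mulnS iterD IH /= !tr_face_step eps0 !addbT negbK addbN signedN.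
set u := signed _ 1.
rewrite -{2 3}(mulr1n (signed dl e)) !face_walkD.
congr (_ - _ *+ _ - z _, _, _, _); [lia|ring|ring].
Qed.

Lemma blk_eq0 dl t d : signed dl e *+ t + z d = 0 -> (n %| t)%N.
Proof.
move/(congr1 blk)/eqP.
by rewrite raddf0 raddfD /= blk_z addr0 signedMn signed_add signed_eq0 blk_eMn natr_ord0.
Qed.

Lemma natr_dvd t : (n %| t)%N -> t%:R = 0 :> 'I_m.
Proof. by move=> nt; apply/eqP; rewrite natr_ord0; apply: dvdn_trans m_dvd_n nt. Qed.

Lemma tr_face_iter_dvd t v dl d s : eps -> (n %| t)%N ->
  iter t face (v, dl, d, s) = (v - signed dl e *+ t, dl, d, s).
Proof.
move=> eps1 nt; rewrite tr_face_iter // -[d *+ t]mulr_natr -![signed _ 1 *+ _]mulr_natr.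
have -> : 'C(t.+1, 2)%:R = 0 :> 'I_m.
  by apply/eqP; rewrite natr_ord0 bin2_dvd // (dvdn_trans m_dvd_n).
by rewrite natr_dvd // !mulr0 !subr0 raddf0 subr0.
Qed.

(** A return to the vertex is a return to its class, so [n] divides [t]; the walk is then the
    translation by a multiple [t] of [e] up to sign, which must vanish. *)
Lemma tr_face_simple p t (x : flag) : eps -> (forall k, e *+ k = 0 -> (p %| k)%N) ->
  vt (iter t face x) = vt x -> (p %| t)%N.
Proof.
case: x => [[[v dl] d] s] eps1 e_ord; rewrite tr_face_iter //.
rewrite /flag_vertex /= => /(bij_inj coset_coord_bij) /eqP.
rewrite -addrA -opprD subr_eq addrC -subr_eq subrr eq_sym => /eqP E.
have nt := blk_eq0 E; apply: e_ord; move: (tr_face_iter t v dl d s eps1).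
rewrite tr_face_iter_dvd // => -[/eqP]; rewrite -addrA -opprD E subr0 subr_eq.
rewrite addrC -subr_eq subrr eq_sym => /eqP H _.
by apply/eqP; rewrite -(signed_eq0 dl) -signedMn H.
Qed.

Lemma tr_face_period p (x : flag) : eps -> e *+ p = 0 -> iter p face x = x.
Proof.
case: x => [[[v dl] d] s] eps1 ep; rewrite tr_face_iter_dvd //.
  by rewrite signedMn ep /signed oppr0 if_same subr0.
by rewrite -natr_ord0 -blk_eMn ep raddf0.
Qed.

(** * Faces of the Petrie dual for odd [n] *)

Section Petrie.
Hypotheses (eps0 : ~~ eps) (n_odd : odd n) (e_n : e *+ n = 0).

Lemma tr_petrie_period (x : flag) : iter (2 * n) face x = x.
Proof.
case: x => [[[v dl] d] s]; rewrite tr_face_iter2 // -[(_ - _) *+ n]mulr_natr.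
rewrite natr_dvd // mulr0 (raddf0 z) subr0 mulnC mulrnA signedMn e_n.
by rewrite /signed oppr0 if_same mul0rn subr0.
Qed.

Lemma tr_petrie_simple t (x : flag) :
  vt (iter t face x) = vt x -> (2 * n %| t)%N.
Proof.
have -> : t = (odd t + 2 * t./2)%N by rewrite mul2n odd_double_half.
case: x => [[[v dl] d] s]; rewrite iterD tr_face_iter2 //.
case: (odd t); last first.
  rewrite /flag_vertex /= => /(bij_inj coset_coord_bij) /eqP.
  rewrite -addrA -opprD subr_eq addrC -subr_eq subrr eq_sym => /eqP /blk_eq0.
  by rewrite Gauss_dvdr ?coprimen2 // => ?; rewrite add0n dvdn_pmul2l.
(* An odd length [2t' + 1] is impossible: it would vanish modulo [m], leaving the fibre shift
   [u (t' + 1) = 0]; doubling this gives [u = 0], whereas [u] is 1 or -1. *)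
rewrite /= tr_face_step /flag_vertex /= => /(bij_inj coset_coord_bij) /eqP.
rewrite -{2}(mulr1n (signed dl e)) face_walkD.
rewrite -addrA -opprD subr_eq addrC -subr_eq subrr eq_sym => /eqP E.
have nt := blk_eq0 E; move: E; case/dvdnP: (nt) => k tE.
rewrite {1}tE mulnC mulrnA signedMn e_n {1}/signed oppr0 if_same mul0rn add0r.
rewrite -(raddf0 z) => /z_inj; set u := signed _ 1; set t' := t./2 in tE nt *.
have t0 := natr_dvd nt; rewrite natrD natrM in t0.
have -> : (d *+ 2 - u) *+ t' + (d - u) =
   d * (2%:R * t'%:R + 1) - u * (t'%:R + 1) by ring.
rewrite t0 mulr0 sub0r => /eqP; rewrite oppr_eq0 => /eqP U.
suff: (u == 0) by rewrite /u signed_eq0.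
have : u * (2%:R * t'%:R + 1) + u = 0.
  have -> : u * (2%:R * t'%:R + 1) + u = (u * (t'%:R + 1)) * 2%:R by ring.
  by rewrite U mul0r.
by rewrite t0 mulr0 add0r => ->.
Qed.
End Petrie.

Lemma tr_lex_flags : lex_flags coset_coord tr0 tr1 tr2 addb.
Proof.
split; [exact: tr0K | exact: tr1K | exact: tr2E | exact: tr0_dir | exact: tr1_dir
  | exact: tr02 | exact: tr1_vt | exact: tr_rot2 | exact: tr0_block | exact: tr0_inj].
Qed.

Lemma tr_connected : connected_flags tr0 tr1 tr2.
Proof. exact (lex_connected m_odd coset_coord_bij tr_lex_flags). Qed.

(** * Automorphisms and orientability of the maps on [V] *)

Local Notation aut_eq := (aut_eq tr0 tr1 tr2).

Lemma tr_aut_shift w v dl d s : aut_eq (v, dl, d, s) (v + w, dl, d, s).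
Proof.
apply: (aut_eq_fun (h := fun x : flag => (x.1.1.1 + w, x.1.1.2, x.1.2, x.2)) _ tr_connected).
move=> [[[{}v {}dl] {}d] {}s]; rewrite !(tr0E, tr1E, tr2E) /=; split=> //.
by congr (_, _, _, _); rewrite -!addrA; congr (_ + _); rewrite [RHS]addrC addrA.
Qed.

(** These automorphisms fix the vertex 0 and permute transitively its edges towards the next
    class. *)
Lemma tr_aut_shear b v dl d s :
  aut_eq (v, dl, d, s) (v + z (b * vertex_res v), dl, d + signed dl b, s).
Proof.
apply: (aut_eq_fun (h := fun x : flag => (x.1.1.1 + z (b * vertex_res x.1.1.1),
  x.1.1.2, x.1.2 + signed x.1.1.2 b, x.2)) _ tr_connected).
move=> [[[{}v {}dl] {}d] {}s]; rewrite !(tr0E, tr1E, tr2E) /=; split=> //; last first.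
  by rewrite signedN opprD addrAC.
rewrite signedN opprD; congr (_, _, _, _).
rewrite !vertex_resD vertex_res_z addr0.
have -> : vertex_res (signed dl e) = signed dl 1.
  by case: dl; rewrite /signed ?vertex_resN vertex_res_e.
have -> : b * (vertex_res v + signed dl 1) = b * vertex_res v + signed dl b.
  by rewrite mulrDr; case: dl; rewrite /signed ?mulrN mulr1.
rewrite !raddfD -!addrA; congr (_ + _); rewrite [RHS]addrCA.
by congr (_ + _); apply: addrCA.
Qed.

Lemma tr_aut_turn v dl d s : aut_eq (v, dl, d, s) (- v, ~~ dl, - d, s).
Proof.
apply: (aut_eq_fun (h := fun x : flag => (- x.1.1.1, ~~ x.1.1.2, - x.1.2, x.2)) _ tr_connected).
move=> [[[{}v {}dl] {}d] {}s]; rewrite !(tr0E, tr1E, tr2E) /=; split=> //.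
  by rewrite signedN (raddfN z) !opprD.
by rewrite opprD addNb signedN.
Qed.

(** A turn corrects the direction, a translation the vertex and a shear [d]; none of them changes
    the side. *)
Lemma tr_aut_base (x : flag) : aut_eq x (0, false, 0, x.2).
Proof.
have base v d s : aut_eq (v, false, d, s) (0, false, 0, s).
  apply: aut_eq_trans (tr_aut_shift (- v) v false d s) _; rewrite subrr.
  have := tr_aut_shear (- d) 0 false d s.
  by rewrite vertex_res0 mulr0 (raddf0 z) addr0 subrr.
case: x => [[[v [] ] d] s] /=; last exact: base.
exact: aut_eq_trans (tr_aut_turn v true d s) (base _ _ _).
Qed.

Lemma tr_aut_eq (x y : flag) : x.2 = y.2 -> aut_eq x y.
Proof.
move=> xy; apply: aut_eq_trans (tr_aut_base x) _; rewrite xy.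
exact: aut_eq_sym (tr_aut_base y).
Qed.

(** Such a [kappa] induces an automorphism exchanging the sides, which merges the two classes of
    flags left by [tr_aut_eq]. *)
Lemma tr_reflexible (kappa : {additive V -> V}) :
  kappa e = e -> (forall d, kappa (z d) = - z d) -> reflexible tr0 tr1 tr2.
Proof.
move=> ke kz.
have mirror v dl d s : aut_eq (v, dl, d, s) (kappa v, dl, - d, ~~ s).
  apply: (aut_eq_fun (h := fun x : flag =>
    (kappa x.1.1.1, x.1.1.2, - x.1.2, ~~ x.2)) _ tr_connected).
  move=> [[[{}v {}dl] {}d] {}s]; rewrite !(tr0E, tr1E, tr2E) /=; split=> //.
    by rewrite !raddfD /= signed_add ke kz (raddfN z) addNb.
  by rewrite opprD addbN signedN.
apply: reflexible_of_aut_eq; try by [exact: tr0K | exact: tr1K].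
  exact: lex_r2K tr_lex_flags.
move=> x y; case: (eqVneq x.2 y.2) => [|xy]; first exact: tr_aut_eq.
case: x xy => [[[v dl] d] s] sy; apply: aut_eq_trans (mirror v dl d s) _.
by apply: tr_aut_eq; case: s sy => /=; case: y.2.
Qed.

(** With [eps], the rotations about vertices and faces both keep the side. *)
Lemma tr_rotary : eps -> rotary tr0 tr1 tr2.
Proof.
move=> eps1; apply: rotary_of_aut_eq; try by [exact: tr0K | exact: tr1K].
- exact: lex_r2K tr_lex_flags.
- move=> [[[v dl] d] s]; apply: tr_aut_eq.
  by rewrite tr2E tr1E /= negbK.
- move=> [[[v dl] d] s]; apply: tr_aut_eq.
  by rewrite tr1E tr0E /= eps1 addbT negbK.
Qed.

Lemma tr_orientable : eps -> orientable tr0 tr1 tr2.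
Proof.
move=> eps1; exists (fun x => x.2) => -[[[v dl] d] s].
by rewrite tr0E tr1E tr2E eps1 addbT.
Qed.

(* An orientation, corrected by the side bit, would be a 2-colouring of the
   vertices changing along every edge, hence along the odd cycle [e *+ t]. *)
Lemma tr_petrie_nonorientable : ~~ eps -> odd n -> e *+ n = 0 -> ~ orientable tr0 tr1 tr2.
Proof.
move=> eps0 n_odd e_n [c cE].
pose col (x : flag) := c x (+) x.2.
have col_vt x y : vt x = vt y -> col x = col y.
  move/eqP; rewrite (lex_same_vertex m_odd coset_coord_bij tr_lex_flags) => xy.
  apply/esym; move: xy (erefl (col x)).
  apply: (@connect_preserves _ _ (fun y => col y = col x)) => {y} u v <-.
  have [_ c1 c2] := cE u; case: u c1 c2 => [[[a dl] d] s] c1 c2.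
  by case/orP=> /eqP ->; rewrite /col ?c1 ?c2 ?tr1E ?tr2E /= addNb addbN negbK.
have walk t : col (e *+ t, false, 0, false) = col (0, false, 0, false) (+) odd t.
  elim: t => [|t IH]; first by rewrite addbF.
  rewrite (@col_vt _ (tr0 (e *+ t, false, 0, false))); last first.
    by rewrite tr0E /flag_vertex /= raddf0 addr0 /signed mulrSr.
  have [c0 _ _] := cE (e *+ t, false, 0, false).
  rewrite {1}/col c0 addNb tr0E /= (negbTE eps0) addbN -IH.
  by [].
have := walk n; rewrite e_n n_odd addbT; by case: (col _).
Qed.

(** * Chirality when [n e] generates the fibre *)

Section Chirality.
Hypotheses (eps1 : eps) (e_n : e *+ n = z 1).

Local Notation half_turns := (iter (2 * (m.+1)./2) (fun y : flag => tr1 (tr2 y))).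

(** A double rotation changes [d] by 2 or -2, and [(m + 1) / 2] inverts 2 modulo [m]. *)
Lemma tr_half_turns v dl d s :
  half_turns (v, dl, d, s) = (v, dl, d + signed (dl (+) s) 1, s).
Proof.
rewrite (lex_rot_iter tr_lex_flags) signedMn -mulrnA mul2n -mul2n.
have -> : (2 * (m.+1)./2)%N = m.+1.
  by rewrite mul2n -[RHS]odd_double_half [odd m.+1]/= -/(odd m) m_odd.
rewrite -natr1 (_ : m%:R = 0) ?add0r //.
by apply/eqP; rewrite natr_ord0.
Qed.

(* Following a face [n] steps comes back to the initial class shifted by
   [z 1], and so does the right-hand word; the two shifts have the same sign
   only on one side of the edge. *)
Lemma tr_chiral_word (x : flag) :
  (iter n face x == half_turns (tr0 (half_turns (tr0 x)))) = x.2.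
Proof.
case: x => [[[v dl] d] s].
rewrite tr_face_iter_dvd // signedMn e_n tr0E eps1 tr_half_turns tr0E tr_half_turns.
rewrite eps1 !addbT !negbK addNb addbN negbK signedN.
set u := signed _ (1 : 'I_m). rewrite [- (- d + u)]opprD opprK subrK.
have -> : v + signed dl e + z d - signed dl e + z (- d + u) = v + z u.
  rewrite raddfD (raddfN z) !addrA; congr (_ + _).
  by rewrite [_ + z d - _]addrAC !addrK.
rewrite !xpair_eqE !eqxx !andbT /= (inj_eq (addrI v)).
rewrite -(signed_add z) -(raddfN z) (inj_eq z_inj) /u {u}.
have n1 : (-1 == 1 :> 'I_m) = false.
  by rewrite eq_sym; apply/negbTE/cyc1_neqN1.
by case: dl; case: s; rewrite /signed /= ?opprK ?eqxx ?n1 // eq_sym.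
Qed.

Lemma tr_chiral : chiral tr0 tr1 tr2.
Proof.
split; [exact: tr_rotary | exact: tr_orientable |].
case=> _ /(_ (0, false, 0, true))[g /map_autP gC [k]].
set x := (0, false, 0, true) => gx.
have [g0 g1 g2] : [/\ forall y, g (tr0 y) = tr0 (g y), forall y, g (tr1 y) = tr1 (g y)
    & forall y, g (tr2 y) = tr2 (g y)] by split=> y; case: (gC y).
have g_iter (f : flag -> flag) t y :
    (forall w, g (f w) = f (g w)) -> g (iter t f y) = iter t f (g y).
  by move=> gf; elim: t => //= t IH; rewrite gf IH.
have g_half y : g (half_turns y) = half_turns (g y).
  by apply: (g_iter (fun y => tr1 (tr2 y))) => w; rewrite g1 g2.
(* The two words agree at [x], whose side is [true]; [g] would carry this equality to [g x], whose
   side is [false]. *)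
have : iter n face x == half_turns (tr0 (half_turns (tr0 x))) by rewrite tr_chiral_word.
move/eqP/(congr1 g); rewrite g_half g0 g_half g0 g_iter => [|w]; last by rewrite g0 g1.
move/eqP; rewrite tr_chiral_word gx tr1E tr_face_iter //.
Qed.

End Chirality.

End TranslationMaps.

(** * The non-orientable map for n = 2 mod 4 *)

Section EvenCycleMaps.
Local Open Scope ring_scope.
Variables (n' m' : nat).
Local Notation n := n'.+3.
Local Notation m := m'.+3.
Hypotheses (m_odd : odd m) (n_even : ~~ odd n) (n_half_odd : odd n./2).

(** Reduction modulo [n] keeps parity because [n] is even; thus classes have a parity, which
    distinguishes the two kinds of edges. *)
Lemma odd_ordD (i j : 'I_n) : odd (@nat_of_ord n (i + j)) = odd i (+) odd j.
Proof. by rewrite /= odd_mod ?oddD //; apply/negbTE. Qed.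

Lemma odd_ordN (i : 'I_n) : odd (@nat_of_ord n (- i)) = odd i.
Proof.
have := odd_ordD (- i) i; rewrite addNr /= => /esym/eqP.
by case: (odd _); case: (odd _).
Qed.

Lemma odd_ord_signed (i : 'I_n) dl : odd (@nat_of_ord n (i + signed dl 1)) = ~~ odd i.
Proof. by rewrite odd_ordD /signed; case: dl; rewrite ?odd_ordN addbT. Qed.

Lemma odd_ord_nat k : odd (@nat_of_ord n k%:R) = odd k.
Proof. by rewrite Zp_nat /= odd_mod //; apply/negbTE. Qed.

Lemma odd_ord_sub2 (i : 'I_n) dl : odd (@nat_of_ord n (i - signed dl 2%:R)) = odd i.
Proof.
by rewrite odd_ordD odd_ordN /signed; case: dl; rewrite ?odd_ordN odd_ord_nat addbF.
Qed.

Local Notation vertex := ('I_n * 'I_m)%type.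
Local Notation flag := (vertex * bool * 'I_m * bool)%type.

(* Unlike for [tr0_fun], the coordinate [k] of [((i, j), dl, k, s)] is the one
   of the other end of the edge. The side bit is kept along the edges from an
   even class [i] to [i + 1] and changed along the others. *)
Definition ev0_fun (x : flag) : flag :=
  let: ((i, j), dl, k, s) := x in ((i + signed dl 1, k), ~~ dl, j, s (+) odd i (+) dl).
Definition ev1_fun (x : flag) : flag :=
  let: (w, dl, k, s) := x in (w, ~~ dl, k + signed s 1, ~~ s).
Definition ev2_fun (x : flag) : flag :=
  let: (w, dl, k, s) := x in (w, dl, k, ~~ s).

Lemma ev0_funK : involutive ev0_fun.
Proof.
move=> [[[[i j] dl] k] s] /=; rewrite negbK signedN addrK odd_ord_signed.
by congr (_, _, _, _); case: s; case: dl; case: (odd i).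
Qed.
Lemma ev1_funK : involutive ev1_fun.
Proof. by move=> [[[w dl] k] s] /=; rewrite !negbK signedN addrK. Qed.
Lemma ev2_funK : involutive ev2_fun.
Proof. by move=> [[[w dl] k] s] /=; rewrite negbK. Qed.

Definition ev0 : {perm flag} := perm (inv_inj ev0_funK).
Definition ev1 : {perm flag} := perm (inv_inj ev1_funK).
Definition ev2 : {perm flag} := perm (inv_inj ev2_funK).

Lemma ev0E i j dl k s : ev0 ((i, j), dl, k, s) =
  ((i + signed dl 1, k), ~~ dl, j, s (+) odd i (+) dl).
Proof. by rewrite permE. Qed.
Lemma ev1E w dl k s : ev1 (w, dl, k, s) = (w, ~~ dl, k + signed s 1, ~~ s).
Proof. by rewrite permE. Qed.
Lemma ev2E w dl k s : ev2 (w, dl, k, s) = (w, dl, k, ~~ s).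
Proof. by rewrite permE. Qed.

Lemma ev_lex_flags : lex_flags (fun w : vertex => w) ev0 ev1 ev2 (fun _ s => ~~ s).
Proof.
split.
- by move=> x; rewrite !permE ev0_funK.
- by move=> x; rewrite !permE ev1_funK.
- exact: ev2E.
- by move=> [[[[i j] dl] k] s]; rewrite ev0E.
- by move=> [[[w dl] k] s]; rewrite ev1E.
- by move=> [[[[i j] dl] k] s]; rewrite ev2E !ev0E ev2E !addNb.
- by move=> [[[w dl] k] s]; rewrite ev1E.
- move=> w dl k s; rewrite !(ev1E, ev2E) !negbK; congr (_, _, _, _).
  by rewrite /signed; case: s => /=; ring.
- by move=> [[[[i j] dl] k] s]; rewrite ev0E.
- by move=> [i j] dl d d' s s'; rewrite !ev0E /flag_vertex /= => -[].
Qed.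

Let idx_bij : bijective (fun w : vertex => w).
Proof. by exists (fun w => w). Qed.

Lemma ev_connected : connected_flags ev0 ev1 ev2.
Proof. exact (lex_connected m_odd idx_bij ev_lex_flags). Qed.

Local Notation face := (fun y : flag => ev0 (ev1 y)).
Local Notation vt := (flag_vertex (fun w : vertex => w)).

Lemma ev_face_step i j dl k s : ev0 (ev1 ((i, j), dl, k, s)) =
  ((i - signed dl 1, k + signed s 1), dl, j, s (+) odd i (+) dl).
Proof. by rewrite ev1E ev0E negbK signedN !addNb addbN negbK. Qed.

Lemma ev_face_step2 i j dl k s : iter 2 face ((i, j), dl, k, s) =
  ((i - signed dl 2%:R, j + signed (s (+) odd i (+) dl) 1), dl, k + signed s 1, ~~ s).
Proof.
rewrite /= !ev_face_step -signedN odd_ord_signed; congr (_, _, _, _, _).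
  by rewrite signedN -addrA; congr (_ + _); case: dl; rewrite /signed; ring.
by case: s; case: dl; case: (odd i).
Qed.

(** Two steps shift [j] and [k] by signs and flip the side, so the next two cancel these shifts. *)
Lemma ev_face_iter4 t i j dl k s : iter (4 * t) face ((i, j), dl, k, s) =
  ((i - signed dl (4 * t)%:R, j), dl, k, s).
Proof.
elim: t => [|t IH]; first by rewrite /signed /= oppr0 if_same subr0.
rewrite mulnS iterD IH (iterD 2 2) !ev_face_step2 negbK odd_ord_sub2.
rewrite !addNb !signedN !addrK; congr (_, _, _, _, _).
by rewrite natrD; case: dl {IH}; rewrite /signed; ring.
Qed.

Lemma ev_face_period x : iter (2 * n) face x = x.
Proof.
case: x => [[[[i j] dl] k] s].
have -> : (2 * n = 4 * n./2)%N.
  by rewrite -[in LHS](odd_double_half n) (negbTE n_even); lia.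
rewrite ev_face_iter4.
have -> : (4 * n./2)%:R = 0 :> 'I_n.
  apply/eqP; rewrite natr_ord0.
  rewrite (_ : 4 * n./2 = 2 * n)%N ?dvdn_mull //.
  by rewrite -[in RHS](odd_double_half n) (negbTE n_even); lia.
by rewrite /signed oppr0 if_same subr0.
Qed.

Lemma ev_face_block t (x : flag) :
  (vt (iter t face x)).1 = (vt x).1 - signed (flag_dir x) t%:R
  /\ flag_dir (iter t face x) = flag_dir x.
Proof.
elim: t => [|t [IH dt]]; first by rewrite /signed /= oppr0 if_same subr0.
rewrite iterS; move: IH dt; case: (iter t face x) => [[[[i j] dl] k] s].
rewrite /= ev_face_step /flag_vertex /flag_dir /= => -> ->; split=> //.
by rewrite -natr1; case: (x.1.1.2); rewrite /signed; ring.
Qed.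

(** The class forces [n] to divide [t], so [t] is even. If [t] is 2 modulo 4, the fibre coordinate
    is off by 1 or -1; otherwise [n = 2 (n / 2)] with [n / 2] odd divides a multiple of 4, and hence
    so does [2n]. *)
Lemma ev_face_simple t (x : flag) : vt (iter t face x) = vt x -> (2 * n %| t)%N.
Proof.
move=> E; have [B _] := ev_face_block t x.
have nt : (n %| t)%N.
  move: B; rewrite E => /eqP; rewrite eq_sym subr_eq addrC -subr_eq subrr eq_sym.
  by rewrite signed_eq0 natr_ord0.
have nE : n = (2 * n./2)%N.
  by rewrite mul2n -[LHS]odd_double_half (negbTE n_even).
have t_even : ~~ odd t.
  by case/dvdnP: nt => k ->; rewrite oddM (negbTE n_even) andbF.
have tE : t = (4 * t./2./2 + 2 * odd t./2)%N.
  rewrite -[LHS]odd_double_half (negbTE t_even) -[in LHS](odd_double_half t./2).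
  by lia.
move: E; case: (odd t./2) tE => /= tE.
  case: x B => [[[[i j] dl] k] s] _; rewrite tE addnC iterD ev_face_iter4.
  rewrite muln1 ev_face_step2 /flag_vertex /= => -[_ /eqP].
  by rewrite -subr_eq0 addrAC subrr add0r signed_eq0.
move=> _; move: nt; rewrite tE nE.
rewrite muln0 addn0 (_ : 4 * _ = 2 * (2 * t./2./2))%N; last by lia.
rewrite dvdn_pmul2l // Gauss_dvdr ?coprimen2 // => ?.
by rewrite !dvdn_pmul2l.
Qed.

Local Notation aut_eq := (aut_eq ev0 ev1 ev2).

(** Even and odd classes are translated independently; [k] belongs to a class of the other parity,
    so there [a] and [b] are exchanged. *)
Lemma ev_aut_translate a b i j dl k s : aut_eq ((i, j), dl, k, s)
  ((i, j + (if odd i then b else a)), dl, k + (if odd i then a else b), s).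
Proof.
apply: (aut_eq_fun (h := fun x : flag => let: ((i, j), dl, k, s) := x in
  ((i, j + (if odd i then b else a)), dl, k + (if odd i then a else b), s))
  _ ev_connected) => -[[[[{}i {}j] {}dl] {}k] {}s].
rewrite !(ev0E, ev1E, ev2E) odd_ord_signed; split=> //.
  by case: (odd i).
by rewrite addrAC.
Qed.

(** Moving up one class exchanges the two kinds of edges. Negating the coordinates of the odd
    classes and flipping the sides at the even ones compensates for this. *)
Lemma ev_aut_shift i j dl k s : aut_eq ((i, j), dl, k, s)
  ((i + 1, signed (odd i) j), dl, signed (~~ odd i) k, s (+) ~~ odd i).
Proof.
apply: (aut_eq_fun (h := fun x : flag => let: ((i, j), dl, k, s) := x in
  ((i + 1, signed (odd i) j), dl, signed (~~ odd i) k, s (+) ~~ odd i))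
  _ ev_connected) => -[[[[{}i {}j] {}dl] {}k] {}s].
have odd1 : odd (@nat_of_ord n (i + 1)) = ~~ odd i by rewrite -(odd_ord_signed i false).
rewrite !(ev0E, ev1E, ev2E) odd_ord_signed odd1 negbK; split.
- by rewrite addrAC; congr (_, _, _, _); case: s; case: dl; case: (odd i).
- congr (_, _, _, _); last by rewrite addNb.
  by case: (odd i); case: s; rewrite /signed /= ?opprD ?opprK.
- by rewrite addNb.
Qed.

(** The reflection of the cycle is centred between 0 and 1 so as to preserve the pairs formed by an
    even class and its successor. *)
Lemma ev_aut_turn i j dl k s : aut_eq ((i, j), dl, k, s) ((1 - i, j), ~~ dl, k, s).
Proof.
apply: (aut_eq_fun (h := fun x : flag => let: ((i, j), dl, k, s) := x in
  ((1 - i, j), ~~ dl, k, s)) _ ev_connected) => -[[[[{}i {}j] {}dl] {}k] {}s].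
rewrite !(ev0E, ev1E, ev2E) odd_ordD odd_ordN; split=> //.
rewrite signedN opprD addrA; congr (_, _, _, _).
by case: s; case: dl; case: (odd i).
Qed.

Lemma ev_aut_mirror i j dl k s :
  aut_eq ((i, j), dl, k, s) ((i, - j), dl, - k, ~~ s).
Proof.
apply: (aut_eq_fun (h := fun x : flag => let: ((i, j), dl, k, s) := x in
  ((i, - j), dl, - k, ~~ s)) _ ev_connected) => -[[[[{}i {}j] {}dl] {}k] {}s].
rewrite !(ev0E, ev1E, ev2E); split=> //; first by rewrite !addNb.
by rewrite opprD signedN.
Qed.

Lemma ev_aut_base (x : flag) : aut_eq x ((0, 0), false, 0, false).
Proof.
have side0 j k s : aut_eq ((0, j), false, k, s) ((0, 0), false, 0, false).
  have trans j' k' s' : aut_eq ((0, j'), false, k', s') ((0, 0), false, 0, s').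
    by have := ev_aut_translate (- j') (- k') 0 j' false k' s'; rewrite /= !subrr.
  case: s; last exact: trans.
  exact: aut_eq_trans (ev_aut_mirror _ _ _ _ _) (trans _ _ _).
have block0 i j k s : aut_eq ((i, j), false, k, s) ((0, 0), false, 0, false).
  have shifts t : exists j' k' s',
      aut_eq ((i, j), false, k, s) ((i + t%:R, j'), false, k', s').
    elim: t => [|t [j' [k' [s' IH]]]].
      by exists j, k, s; rewrite addr0; apply: aut_eq_refl.
    exists (signed (odd (@nat_of_ord n (i + t%:R))) j'), (signed (~~ odd (@nat_of_ord n (i + t%:R))) k').
    exists (s' (+) ~~ odd (@nat_of_ord n (i + t%:R))); apply: aut_eq_trans IH _.
    by rewrite -natr1 addrA; apply: ev_aut_shift.
  have [j' [k' [s' H]]] := shifts (nat_of_ord (- i)).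
  rewrite natr_ordE subrr in H.
  exact: aut_eq_trans H (side0 _ _ _).
case: x => [[[[i j] []] k] s]; last exact: block0.
exact: aut_eq_trans (ev_aut_turn i j true k s) (block0 _ _ _ _).
Qed.

Lemma ev_reflexible : reflexible ev0 ev1 ev2.
Proof.
apply: reflexible_of_aut_eq.
- exact: lf_r0K ev_lex_flags.
- exact: lf_r1K ev_lex_flags.
- exact: lex_r2K ev_lex_flags.
- move=> x y; apply: aut_eq_trans (ev_aut_base x) _.
  exact: aut_eq_sym (ev_aut_base y).
Qed.

(* An orientation, corrected by the side bit, would be a 2-colouring of the
   vertices changing exactly along the edges from even classes [i] to [i + 1],
   of which a closed path round the cycle has the odd number [n./2]. *)
Lemma ev_nonorientable : ~ orientable ev0 ev1 ev2.
Proof.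
move=> [c cE].
pose col (x : flag) := c x (+) x.2.
have col_vt x y : vt x = vt y -> col x = col y.
  move/eqP; rewrite (lex_same_vertex m_odd idx_bij ev_lex_flags) => xy.
  apply/esym; move: xy (erefl (col x)).
  apply: (@connect_preserves _ _ (fun y => col y = col x)) => {y} u v <-.
  have [_ c1 c2] := cE u; case: u c1 c2 => [[[a dl] d] s] c1 c2.
  by case/orP=> /eqP ->; rewrite /col ?c1 ?c2 ?ev1E ?ev2E /= addNb addbN negbK.
(* [uphalf t] is the number of even integers below [t]. *)
have walk t : col ((t%:R, 0), false, 0, false) =
    col ((0, 0), false, 0, false) (+) odd (uphalf t).
  elim: t => [|t IH]; first by rewrite addbF.
  rewrite (@col_vt _ (ev0 ((t%:R, 0), false, 0, false))); last first.
    by rewrite ev0E /flag_vertex /= -natr1.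
  have [c0 _ _] := cE ((t%:R, 0), false, 0, false).
  move: IH; rewrite {1 3}/col c0 ev0E /= odd_ord_nat !addbF addNb => ->.
  rewrite uphalf_half oddD oddb.
  by case: (col _); case: (odd t); case: (odd _).
have := walk n; rewrite uphalf_half (negbTE n_even) n_half_odd.
have -> : n%:R = 0 :> 'I_n by apply/eqP; rewrite natr_ord0.
by case: (col _).
Qed.

End EvenCycleMaps.

(** * The vertex groups and the theorem *)

HB.instance Definition _ (A B : finZmodType) := Finite.on (A * B)%type.

(** * The group Z/n x Z/m, for [c = 0] *)

Section SplitTorus.
Local Open Scope ring_scope.
Variables (n' m' : nat).
Local Notation n := n'.+3.
Local Notation m := m'.+3.

Definition split_fiber (d : 'I_m) : 'I_n * 'I_m := (0, d).
Definition split_class (v : 'I_n * 'I_m) : 'I_n := v.1.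
Definition split_mirror (v : 'I_n * 'I_m) : 'I_n * 'I_m := (v.1, - v.2).

Fact split_fiber_zmod : zmod_morphism split_fiber.
Proof. by move=> a b; rewrite /split_fiber; congr (_, _); rewrite /= subrr. Qed.
Fact split_class_zmod : zmod_morphism split_class.
Proof. by []. Qed.
Fact split_mirror_zmod : zmod_morphism split_mirror.
Proof. by move=> a b; rewrite /split_mirror; congr (_, _); rewrite /= opprD. Qed.
HB.instance Definition _ := GRing.isZmodMorphism.Build _ _ split_fiber split_fiber_zmod.
HB.instance Definition _ := GRing.isZmodMorphism.Build _ _ split_class split_class_zmod.
HB.instance Definition _ := GRing.isZmodMorphism.Build _ _ split_mirror split_mirror_zmod.

Definition split_step : 'I_n * 'I_m := (1, 0).

Lemma split_stepMn k : split_step *+ k = (k%:R, 0).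
Proof. by elim: k => // k IH; rewrite mulrSr IH -natr1; congr (_, _); rewrite /= addr0. Qed.

Lemma split_mirror_step : split_mirror split_step = split_step.
Proof. by congr (_, _); rewrite /= oppr0. Qed.

Lemma split_mirror_fiber d : split_mirror (split_fiber d) = - split_fiber d.
Proof. by congr (_, _); rewrite /= oppr0. Qed.

Lemma split_class_ker v : split_class v = 0 -> exists d, v = split_fiber d.
Proof. by case: v => [i j] /= ->; exists j. Qed.

Lemma split_fiber_inj : injective split_fiber.
Proof. by move=> a b []. Qed.

Lemma split_step_eq0 k : split_step *+ k = 0 -> (n %| k)%N.
Proof. by rewrite split_stepMn => -[/eqP]; rewrite natr_ord0. Qed.

Lemma split_step_n : split_step *+ n = 0.
Proof. by rewrite split_stepMn; congr (_, _); apply/eqP; rewrite natr_ord0. Qed.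

End SplitTorus.

(** * The cyclic group of order [nm], for [c = 1] *)

Section CyclicTorus.
Local Open Scope ring_scope.
Variables (n' m' k : nat).
Local Notation n := n'.+3.
Local Notation m := m'.+3.
Hypothesis kE : k.+2 = (n * m)%N.

(** With [e = 1], the fibre consists of the multiples of [n], so that [n e] is its generator
    [cyc_fiber 1]. *)
Definition cyc_fiber (d : 'I_m) : 'I_k.+2 := (n * d)%:R.
Definition cyc_class (v : 'I_k.+2) : 'I_n := (nat_of_ord v)%:R.

Lemma natr_mod_ord p q : (p.+2 %| q)%N -> forall a, (a %% q)%:R = a%:R :> 'I_p.+2.
Proof.
move=> pq a; rewrite [in RHS](divn_eq a q) natrD natrM.
by rewrite (_ : q%:R = 0) ?mulr0 ?add0r //; apply/eqP; rewrite natr_ord0.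
Qed.

Fact cyc_class_zmod : zmod_morphism cyc_class.
Proof.
have D a b : cyc_class (a + b) = cyc_class a + cyc_class b.
  by rewrite /cyc_class /= natr_mod_ord ?natrD // kE dvdn_mulr.
move=> a b; apply/eqP; rewrite eq_sym subr_eq -D subrK //.
Qed.
Fact cyc_fiber_zmod : zmod_morphism cyc_fiber.
Proof.
have D a b : cyc_fiber (a + b) = cyc_fiber a + cyc_fiber b.
  rewrite /cyc_fiber /= muln_modr natr_mod_ord ?mulnDr ?natrD // kE //.
move=> a b; apply/eqP; rewrite eq_sym subr_eq -D subrK //.
Qed.
HB.instance Definition _ := GRing.isZmodMorphism.Build _ _ cyc_class cyc_class_zmod.
HB.instance Definition _ := GRing.isZmodMorphism.Build _ _ cyc_fiber cyc_fiber_zmod.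

Definition cyc_class_additive : {additive 'I_k.+2 -> 'I_n} := cyc_class.
Definition cyc_fiber_additive : {additive 'I_m -> 'I_k.+2} := cyc_fiber.

Lemma cyc_class_fiber d : cyc_class (cyc_fiber d) = 0.
Proof.
rewrite /cyc_class [cyc_fiber d]Zp_nat /= natr_mod_ord ?kE ?dvdn_mulr //.
by apply/eqP; rewrite natr_ord0 dvdn_mulr.
Qed.

Lemma cyc_fiber_inj : injective cyc_fiber.
Proof.
move=> a b /eqP; rewrite -subr_eq0 -(raddfB cyc_fiber) /cyc_fiber natr_ord0 kE.
by rewrite dvdn_pmul2l // -natr_ord0 natr_ordE subr_eq0 => /eqP.
Qed.

Lemma cyc_class_ker v : cyc_class v = 0 -> exists d, v = cyc_fiber d.
Proof.
move/eqP; rewrite natr_ord0 => /dvdnP[q vE].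
have qm : (q < m)%N.
  by have := ltn_ord v; rewrite vE [X in (_ < X)%N]kE mulnC ltn_pmul2l.
by exists (Ordinal qm); rewrite /cyc_fiber /= mulnC -vE natr_ordE.
Qed.

Lemma cyc_fiber1 : (1 : 'I_k.+2) *+ n = cyc_fiber 1.
Proof. by rewrite /cyc_fiber /= muln1. Qed.

End CyclicTorus.

(** * The maps of the theorem *)

Section Families.
Variables (n' m' : nat).
Local Notation n := n'.+3.
Local Notation m := m'.+3.
Hypotheses (m_odd : odd m) (m_dvd_n : m %| n).

(** The face length is the order [nm] of [e = 1], which leaves [2m] faces. *)
Lemma chiral_lex_map : exists (F : finType) (r0 r1 r2 : {perm F}),
  [/\ is_map r0 r1 r2 /\ polytopal r0 r1 r2,
      skeleton_is r0 r1 r2 (lex_cycle_adj n m),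
      chiral r0 r1 r2, has_type r0 r1 r2 (m * n) (2 * m)
    & euler_char r0 r1 r2 = (Posz (n * m) - Posz (n * m * m) + Posz (2 * m))%R].
Proof.
have [k kE] : exists k, k.+2 = n * m by exists (n * m).-2; lia.
pose z : {additive 'I_m -> 'I_k.+2} := cyc_fiber_additive kE.
pose blk : {additive 'I_k.+2 -> 'I_n} := cyc_class_additive kE.
have blk_e : blk 1%R = 1%R by [].
have blk_z : forall d, blk (z d) = 0%R := cyc_class_fiber kE.
have z_inj : injective z := cyc_fiber_inj kE.
have ker : forall v, blk v = 0%R -> exists d, v = z d := cyc_class_ker kE.
have e_n : (1 *+ n)%R = z 1%R := cyc_fiber1 _ _ _.
have e_ord q : (1 *+ q = 0 :> 'I_k.+2)%R <-> n * m %| q.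
  by rewrite -kE -natr_ord0; split=> /eqP.
exists _, (tr0 1%R z true), (tr1 _ _), (tr2 _ _).
have [] := @lex_map _ _ m_odd _ _ (coset_coord_bij blk_e blk_z z_inj ker)
  _ _ _ _ (tr_lex_flags blk_e blk_z z_inj ker true) (m * n) _ _ _ (2 * m).
- by rewrite muln_gt0.
- move=> x; apply: (tr_face_period m_odd m_dvd_n z blk_e) => //.
  by apply/e_ord; rewrite mulnC.
- move=> t x; apply: (tr_face_simple m_odd m_dvd_n blk_e blk_z z_inj ker) => // q /e_ord.
  by rewrite mulnC.
- lia.
- split=> //.
  exact: (tr_chiral m_odd m_dvd_n blk_e blk_z z_inj ker isT e_n).
Qed.

(** Here [e] has order [n], which leaves [2m^2] faces, and negation of the fibre is a reflection. *)
Lemma orientable_lex_map : exists (F : finType) (r0 r1 r2 : {perm F}),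
  [/\ is_map r0 r1 r2 /\ polytopal r0 r1 r2,
      skeleton_is r0 r1 r2 (lex_cycle_adj n m),
      reflexible r0 r1 r2 /\ orientable r0 r1 r2, has_type r0 r1 r2 n (2 * m)
    & euler_char r0 r1 r2 = (Posz (n * m) - Posz (n * m * m) + Posz (2 * m * m))%R].
Proof.
pose z : {additive 'I_m -> 'I_n * 'I_m} := @split_fiber n' m'.
pose blk : {additive 'I_n * 'I_m -> 'I_n} := @split_class n' m'.
pose e := split_step n' m'.
have blk_e : blk e = 1%R by [].
have blk_z : forall d, blk (z d) = 0%R by [].
have z_inj : injective z := @split_fiber_inj n' m'.
have ker : forall v, blk v = 0%R -> exists d, v = z d := @split_class_ker n' m'.
exists _, (tr0 e z true), (tr1 _ _), (tr2 _ _).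
have [] := @lex_map _ _ m_odd _ _ (coset_coord_bij blk_e blk_z z_inj ker)
  _ _ _ _ (tr_lex_flags blk_e blk_z z_inj ker true) n _ _ _ (2 * m * m).
- by [].
- by move=> x; apply: (tr_face_period m_odd m_dvd_n z blk_e) => //; apply: split_step_n.
- by move=> t x; apply: (tr_face_simple m_odd m_dvd_n blk_e blk_z z_inj ker) => //; apply: split_step_eq0.
- lia.
- split=> //; split; last exact: tr_orientable.
  apply: (tr_reflexible m_odd m_dvd_n blk_e blk_z z_inj ker _ (kappa := @split_mirror n' m')).
    exact: split_mirror_step.
  exact: split_mirror_fiber.
Qed.

Lemma nonorientable_lex_map_odd : odd n -> exists (F : finType) (r0 r1 r2 : {perm F}),
  [/\ is_map r0 r1 r2 /\ polytopal r0 r1 r2,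
      skeleton_is r0 r1 r2 (lex_cycle_adj n m),
      reflexible r0 r1 r2 /\ ~ orientable r0 r1 r2, has_type r0 r1 r2 (2 * n) (2 * m)
    & euler_char r0 r1 r2 = (Posz (n * m) - Posz (n * m * m) + Posz (m * m))%R].
Proof.
move=> n_odd.
pose z : {additive 'I_m -> 'I_n * 'I_m} := @split_fiber n' m'.
pose blk : {additive 'I_n * 'I_m -> 'I_n} := @split_class n' m'.
pose e := split_step n' m'.
have blk_e : blk e = 1%R by [].
have blk_z : forall d, blk (z d) = 0%R by [].
have z_inj : injective z := @split_fiber_inj n' m'.
have ker : forall v, blk v = 0%R -> exists d, v = z d := @split_class_ker n' m'.
have e_n : (e *+ n = 0)%R := split_step_n n' m'.
exists _, (tr0 e z false), (tr1 _ _), (tr2 _ _).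
have [] := @lex_map _ _ m_odd _ _ (coset_coord_bij blk_e blk_z z_inj ker)
  _ _ _ _ (tr_lex_flags blk_e blk_z z_inj ker false) (2 * n) _ _ _ (m * m).
- by [].
- by move=> x; apply: (tr_petrie_period m_odd m_dvd_n).
- by move=> t x; apply: (tr_petrie_simple m_odd m_dvd_n blk_e blk_z z_inj ker).
- lia.
- split=> //; split.
    apply: (tr_reflexible m_odd m_dvd_n blk_e blk_z z_inj ker _ (kappa := @split_mirror n' m')).
      exact: split_mirror_step.
    exact: split_mirror_fiber.
  exact: (tr_petrie_nonorientable m_odd blk_e blk_z z_inj ker).
Qed.

Lemma nonorientable_lex_map_even : ~~ odd n -> odd n./2 ->
  exists (F : finType) (r0 r1 r2 : {perm F}),
  [/\ is_map r0 r1 r2 /\ polytopal r0 r1 r2,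
      skeleton_is r0 r1 r2 (lex_cycle_adj n m),
      reflexible r0 r1 r2 /\ ~ orientable r0 r1 r2, has_type r0 r1 r2 (2 * n) (2 * m)
    & euler_char r0 r1 r2 = (Posz (n * m) - Posz (n * m * m) + Posz (m * m))%R].
Proof.
move=> n_even n_half.
have idx_bij : bijective (fun w : 'I_n * 'I_m => w) by exists id.
exists _, (ev0 m' n_even), (ev1 _ _), (ev2 _ _).
have [] := @lex_map _ _ m_odd _ _ idx_bij _ _ _ _ (ev_lex_flags m' n_even) (2 * n) _ _ _ (m * m).
- by [].
- exact: ev_face_period.
- by move=> t x; apply: ev_face_simple.
- lia.
- split=> //; split; first exact: ev_reflexible.
  exact: ev_nonorientable.
Qed.

End Families.

Theorem theorem1p1 (s m : nat) :
  0 < s -> ~~ (4 %| s) -> 3 <= m -> odd m ->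
  let n := (s * m)%N in
  let h : int := Posz ((m - 1) %/ 2) in
  [/\ (* (1) chiral, type {mn, 2m}, orientable genus 1 + m(n(m-1)/2 - 1) *)
      exists (F : finType) (r0 r1 r2 : {perm F}),
        [/\ is_map r0 r1 r2 /\ polytopal r0 r1 r2,
            skeleton_is r0 r1 r2 (lex_cycle_adj n m),
            chiral r0 r1 r2, has_type r0 r1 r2 (m * n) (2 * m)
          & (2 - euler_char r0 r1 r2 =
               2 * (1 + Posz m * (Posz n * h - 1)))%R],
      (* (2) orientable reflexible, type {n, 2m}, genus 1 + m(n(m-1)/2 - m) *)
      exists (F : finType) (r0 r1 r2 : {perm F}),
        [/\ is_map r0 r1 r2 /\ polytopal r0 r1 r2,
            skeleton_is r0 r1 r2 (lex_cycle_adj n m),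
            reflexible r0 r1 r2 /\ orientable r0 r1 r2,
            has_type r0 r1 r2 n (2 * m)
          & (2 - euler_char r0 r1 r2 =
               2 * (1 + Posz m * (Posz n * h - Posz m)))%R]
    & (* (3) non-orientable reflexible, type {2n, 2m},
         non-orientable genus 2 + m(n(m-1) - m) *)
      exists (F : finType) (r0 r1 r2 : {perm F}),
        [/\ is_map r0 r1 r2 /\ polytopal r0 r1 r2,
            skeleton_is r0 r1 r2 (lex_cycle_adj n m),
            reflexible r0 r1 r2 /\ ~ orientable r0 r1 r2,
            has_type r0 r1 r2 (2 * n) (2 * m)
          & (2 - euler_char r0 r1 r2 =
               2 + Posz m * (Posz n * (Posz m - 1) - Posz m))%R]].
Proof.
move=> s_gt0 s4 m_ge3 m_odd n h.
have m_dvd_n : m %| n by rewrite /n dvdn_mull.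
have n_ge3 : 3 <= n by rewrite /n; nia.
have n_odd : odd n = odd s by rewrite /n oddM m_odd andbT.
(* As [m] is odd, 4 does not divide [n] either; an even [n] is therefore 2 modulo 4. *)
have n_half : ~~ odd n -> odd n./2.
  rewrite n_odd => s_even; have sE := odd_double_half s.
  rewrite (negbTE s_even) add0n in sE.
  rewrite /n -sE -doubleMl doubleK oddM m_odd andbT.
  apply: contraR s4 => half_even; rewrite -sE -(odd_double_half s./2) (negbTE half_even).
  by rewrite add0n -!mul2n mulnA dvdn_mulr.
have mE : Posz m = (2 * h + 1)%R.
  by rewrite /h; lia.
clearbody n h; move: m_ge3 n_ge3 => /subnKC mS /subnKC nS.
move: m_odd m_dvd_n n_half mE; rewrite -mS -nS !(addSn, add0n).
move: (m - 3) (n - 3) => m' n' m_odd m_dvd_n n_half mE; split.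
- have [F [r0 [r1 [r2 [map skel chir type chi]]]]] := chiral_lex_map m_odd m_dvd_n.
  exists F, r0, r1, r2; split=> //; rewrite chi !PoszM mE; ring.
- have [F [r0 [r1 [r2 [map skel refl type chi]]]]] := orientable_lex_map m_odd m_dvd_n.
  exists F, r0, r1, r2; split=> //; rewrite chi !PoszM mE; ring.
- have [F [r0 [r1 [r2 [map skel refl type chi]]]]] :
      exists (F : finType) (r0 r1 r2 : {perm F}),
      [/\ is_map r0 r1 r2 /\ polytopal r0 r1 r2,
          skeleton_is r0 r1 r2 (lex_cycle_adj n'.+3 m'.+3),
          reflexible r0 r1 r2 /\ ~ orientable r0 r1 r2,
          has_type r0 r1 r2 (2 * n'.+3) (2 * m'.+3)
        & euler_char r0 r1 r2 = (Posz (n'.+3 * m'.+3) -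
            Posz (n'.+3 * m'.+3 * m'.+3) + Posz (m'.+3 * m'.+3))%R].
    have [n_odd3|n_even] := boolP (odd n'.+3).
      exact: nonorientable_lex_map_odd.
    exact: nonorientable_lex_map_even (n_half n_even).
  exists F, r0, r1, r2; split=> //; rewrite chi !PoszM mE; ring.
Qed.
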